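(* Let $\{X_\alpha\}$ be an arbitrary family (indexed by an arbitrary set) of positive real-valued random variables, with distribution functions $F_\alpha(t)=\mathbb{P}(X_\alpha\le t)$. The following are equivalent: (i) there exists an integrable random variable $Y$ such that $X_\alpha \le_{\mathrm{icx}} Y$ for all $\alpha$; (ii) $\{X_\alpha\}$ is uniformly integrable, i.e. $\sup_\alpha \mathbb{E}\, X_\alpha 1(X_\alpha>t)\to 0$ as $t\to\infty$; (iii) $\lim_{t\to\infty}\sup_\alpha \int_t^\infty (1-F_\alpha(u))\,du = 0$.
   Context: ''Positive'' means nonnegative. The random variables need not be defined on a common probability space; each $X_\alpha$ lives on its own probability space and $\mathbb{E}$ denotes expectation there. For positive random variables $X_1,X_2$, $X_1\le_{\mathrm{icx}} X_2$ (increasing convex order) means $\mathbb{E}\phi(X_1)\le\mathbb{E}\phi(X_2)$ for all increasing (nondecreasing) convex functions $\phi:\mathbb{R}_+\to\mathbb{R}_+$; equivalently, $\mathbb{E}(X_1-t)_+\le \mathbb{E}(X_2-t)_+$ for all $t\ge 0$, where $x_+=\max(x,0)$. *)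

(* Defs.v *)
From HB Require Import structures.
From mathcomp Require Import all_boot all_order all_algebra.
From mathcomp Require Import all_classical all_reals all_analysis.
Set Implicit Arguments. Unset Strict Implicit. Unset Printing Implicit Defensive.
Import Order.TTheory GRing.Theory Num.Theory.
Local Open Scope classical_set_scope.
Local Open Scope ring_scope.

Definition incr_convex_pos {R : realType} (phi : R -> R) : Prop :=
  (forall x, 0 <= x -> 0 <= phi x) /\
  (forall x y, 0 <= x -> x <= y -> phi x <= phi y) /\
  (forall x y t, 0 <= x -> 0 <= y -> 0 <= t -> t <= 1 ->
      phi (t * x + (1 - t) * y) <= t * phi x + (1 - t) * phi y).

Definition icx_le {R : realType}
  {d1 : measure_display} {T1 : measurableType d1} (P1 : probability T1 R) (X1 : T1 -> R)
  {d2 : measure_display} {T2 : measurableType d2} (P2 : probability T2 R) (X2 : T2 -> R)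
  : Prop :=
  forall phi : R -> R, incr_convex_pos phi ->
    (\int[P1]_x (phi (X1 x))%:E <= \int[P2]_x (phi (X2 x))%:E)%E.

Definition pos_rv {R : realType} {d : measure_display} {T : measurableType d}
  (X : T -> R) : Prop := measurable_fun setT X /\ forall x, 0 <= X x.

(* supremum over an index family of [0,+oo]-valued quantities,
   with the convention that the supremum of the empty family is 0 *)
Definition sup_pos {R : realType} {I : Type} (f : I -> \bar R) : \bar R :=
  ereal_sup ([set 0%E] `|` range f).

(* Main.v *)
Require Import Defs.
From HB Require Import structures.
From mathcomp Require Import all_boot all_order all_algebra.
From mathcomp Require Import all_classical all_reals all_analysis.
From mathcomp Require Import measurable_realfun ring lra.
Import Order.TTheory GRing.Theory Num.Theory.
Import numFieldNormedType.Exports.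
Local Open Scope classical_set_scope.
Local Open Scope ring_scope.

(** Everything is expressed through the stop-loss transform [E (X - t)_+], which
    equals the tail integral of [1 - F] over the half-line from [t] and satisfies
    [E (X - t)_+ <= E X 1(X > t)] and [E X 1(X > 2 t) <= 2 E (X - t)_+]; so (ii)
    and (iii) both say that the supremum [H t] of the stop-loss transforms of the
    family tends to [0], and (i) implies this by dominated convergence. Conversely
    [H] is convex with slopes between [-1] and [0] and limit [0], so there is an
    integer-valued [Y] with [P (Y > n) = H n - H (n + 1)], and then
    [E (Y - n)_+ = H n] for every integer [n]. Integer thresholds are enough: an
    increasing convex [phi] is dominated by its chord interpolation at the
    integers, a nonnegative combination of a constant and the [(x - n)_+], and the
    two agree on the values of [Y]. *)

(** * The stop-loss transform compared with tail integrals *)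

Definition excess {R : realType} (t x : R) : R := Num.max (x - t) 0.

Lemma excess_ge0 {R : realType} (t x : R) : 0 <= excess t x.
Proof. by rewrite /excess le_max lexx orbT. Qed.

Definition stop_loss {R : realType} {d : measure_display} {T : measurableType d}
  (P : probability T R) (X : T -> R) (t : R) : \bar R :=
  (\int[P]_x (excess t (X x))%:E)%E.

Section StopLoss.
Context {R : realType} {d : measure_display} {T : measurableType d}.
Variables (P : probability T R) (X : T -> R).
Hypothesis hX : pos_rv X.
Local Open Scope ereal_scope.

Let mX : measurable_fun setT X. Proof. by case: hX. Qed.
Let X_ge0 x : (0 <= X x)%R. Proof. by case: hX. Qed.

Lemma measurable_excess (t : R) : measurable_fun setT (EFin \o (excess t \o X)).
Proof.
apply/measurable_EFinP; apply: measurable_maxr => //.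
exact: measurable_funB.
Qed.

Lemma measurable_gt (t : R) : measurable [set x | (t < X x)%R].
Proof. by rewrite -[X in measurable X]setTI; apply: measurable_fun_ltr. Qed.

Lemma measurable_restrict_gt (t : R) :
  measurable_fun setT ((EFin \o X) \_ [set x | (t < X x)%R]).
Proof.
apply/(measurable_restrictT _ (measurable_gt t)).
by apply: measurable_funTS; apply/measurable_EFinP.
Qed.

Lemma stop_loss_ge0 (t : R) : 0 <= stop_loss P X t.
Proof. by apply: integral_ge0 => x _; rewrite lee_fin excess_ge0. Qed.

(* Since E max(X, t) = t + E (X - t)_+, the tail formula for expectations applied
   to max(X, t) gives the claim, its integral over [0, t[ being t. *)
Lemma stop_loss_tail (t : R) : (0 <= t)%R ->
  \int[lebesgue_measure]_(u in `[t, +oo[) (1 - P [set x | (X x <= u)%R]) =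
  stop_loss P X t.
Proof.
move=> t0.
have mM : measurable_fun setT (fun x => Num.max (X x) t) by exact: measurable_maxr.
pose Mf : {mfun T >-> R} := HB.pack (fun x => Num.max (X x) t)
  (@isMeasurableFun.Build _ _ _ _ _ mM).
have M0 x : (0 <= Mf x)%R by rewrite /= le_max X_ge0.
have := @ge0_expectation_ccdf _ _ R P Mf M0.
have -> : 'E_P[Mf] = t%:E + stop_loss P X t.
  rewrite expectation_def /stop_loss.
  rewrite -[t%:E]mule1 -(probability_setT P) -integral_cst//.
  rewrite -ge0_integralD//.
  - apply: eq_integral => x _ /=; rewrite -EFinD; congr EFin.
    by rewrite addr_maxr addr0 addrC subrK.
  - by move=> x _; rewrite lee_fin excess_ge0.
  - exact: measurable_excess.
have -> : `[0%R, +oo[%classic = `[0%R, t[%classic `|` `[t, +oo[%classic :> set R.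
  by rewrite -itv_bndbnd_setU// bnd_simp.
rewrite ge0_integral_setU//=; last 2 first.
- by apply: measurable_funTS; exact: ccdf_measurable.
- apply/disj_setPS => x /= [] /=; rewrite !in_itv/= andbT => /andP[_ xt] tx.
  by move: (lt_le_trans xt tx); rewrite ltxx.
have -> : \int[lebesgue_measure]_(r in `[0%R, t[) ccdf (P:=P) Mf r = t%:E.
  transitivity (\int[lebesgue_measure]_(r in `[0%R, t[) (cst 1 r : \bar R)).
    apply: eq_integral => r; rewrite inE/= in_itv/= => /andP[_ rt].
    rewrite -[RHS](probability_setT P) /ccdf /=; congr (P _).
    by apply/seteqP; split=> // x _ /=; rewrite in_itv/= andbT lt_max rt orbT.
  rewrite integral_cst// mul1e.
  transitivity (lebesgue_measure (`[0%R, t[%classic : set R)); first by [].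
  rewrite lebesgue_measure_itv/= lte_fin.
  by case: ltgtP t0 => // [|<-] *; rewrite ?oppr0 ?adde0// sube0.
have -> : \int[lebesgue_measure]_(r in `[t, +oo[) ccdf (P:=P) Mf r =
    \int[lebesgue_measure]_(r in `[t, +oo[) (1 - P [set x | (X x <= r)%R]).
  apply: eq_integral => r; rewrite inE/= in_itv/= andbT => tr.
  rewrite ccdf_1_cdf /cdf /=; congr (1 - P _).
  apply/seteqP; split=> x /=; rewrite in_itv/= ge_max ?tr ?andbT//.
by move=> h; rewrite -[RHS](@addeK R t%:E)// (addeC (stop_loss P X t)) h (addeC t%:E) addeK.
Qed.

Lemma stop_loss_le (t : R) : (0 <= t)%R ->
  stop_loss P X t <= \int[P]_(x in [set x | (t < X x)%R]) (X x)%:E.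
Proof.
move=> t0; rewrite [leRHS]integral_mkcond; apply: ge0_le_integral => //.
- by move=> x _; rewrite lee_fin excess_ge0.
- exact: measurable_excess.
- exact: measurable_restrict_gt.
move=> x _; rewrite patchE; case: ifPn; rewrite ?inE ?notin_setE/=.
  by move=> tX; rewrite lee_fin ge_max X_ge0 andbT lerBlDr lerDl.
by move/negP; rewrite -leNgt => Xt; rewrite lee_fin ge_max lexx subr_le0 Xt.
Qed.

(** Where [X > 2 t], the inequality [t < X / 2] gives [X <= 2 (X - t)]; elsewhere the restricted
    integrand is 0. *)
Lemma le_stop_loss (t : R) : (0 <= t)%R ->
  \int[P]_(x in [set x | (2 * t < X x)%R]) (X x)%:E <= 2%:E * stop_loss P X t.
Proof.
move=> t0; rewrite integral_mkcond /stop_loss -ge0_integralZl_EFin//; last 2 first.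
- by move=> x _; rewrite lee_fin excess_ge0.
- exact: measurable_excess.
apply: ge0_le_integral => //.
- by move=> x _; apply: erestrict_ge0 => y _; rewrite lee_fin.
- exact: measurable_restrict_gt.
- by apply: measurable_funeM; exact: measurable_excess.
move=> x _; rewrite patchE; case: ifPn; rewrite ?inE ?notin_setE/=.
  move=> tX; rewrite -EFinM lee_fin; rewrite -ler_pdivrMl// le_max; apply/orP; left; lra.
by move=> _; rewrite mule_ge0// lee_fin excess_ge0.
Qed.

End StopLoss.

(** * Suprema of nonnegative families and their limits *)

Section SupPos.
Context {R : realType} {I : Type}.
Local Open Scope ereal_scope.
Implicit Types (f g : I -> \bar R).

Lemma sup_pos_ge0 f : 0 <= sup_pos f.
Proof. by apply: ereal_sup_ubound; left. Qed.

Lemma sup_pos_ub f i : f i <= sup_pos f.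
Proof. by apply: ereal_sup_ubound; right; exists i. Qed.

Lemma sup_pos_le f (M : \bar R) : 0 <= M -> (forall i, f i <= M) -> sup_pos f <= M.
Proof. by move=> M0 fM; apply: ge_ereal_sup => _ [->//|[i _ <-]]. Qed.

(** Squeeze: the bound is uniform in [i], so it passes to the suprema, and the value 0 adjoined in
    [sup_pos] bounds them below. The rescaling [s] allows the two sides to be compared at different
    thresholds. *)
Lemma sup_pos_cvg0_le (f g : I -> R -> \bar R) (s : R -> R) (c : R) :
  (0 <= c)%R -> s t @[t --> +oo%R] --> +oo%R ->
  (\forall t \near +oo%R, forall i, f i t <= c%:E * g i (s t)) ->
  sup_pos (fun i => g i t) @[t --> +oo%R] --> 0 ->
  sup_pos (fun i => f i t) @[t --> +oo%R] --> 0.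
Proof.
move=> c0 sy fg g0.
apply: (@squeeze_cvge _ _ _ _ (cst 0) _
  (fun t => c%:E * sup_pos (fun i => g i (s t)))).
- near=> t; rewrite sup_pos_ge0/=; apply: sup_pos_le.
    by rewrite mule_ge0// sup_pos_ge0.
  move=> i; have /le_trans : f i t <= c%:E * g i (s t).
    by move: i; near: t.
  apply; rewrite lee_wpmul2l//; exact: (sup_pos_ub (fun i => g i (s t))).
- exact: cvg_cst.
- rewrite -[X in _ --> X](mule0 c%:E); apply: cvgeZl => //.
  exact: (cvg_comp _ _ sy g0).
Unshelve. all: by end_near. Qed.

End SupPos.

(** * Conditions (ii) and (iii), and the consequence of (i), in terms of stop-loss transforms *)

Section Equivalences.
Context {R : realType} {I : Type} {d : I -> measure_display}
  {T : forall i, measurableType (d i)}.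
Variables (P : forall i, probability (T i) R) (X : forall i, T i -> R).
Hypothesis hX : forall i, pos_rv (X i).
Local Open Scope ereal_scope.

Lemma sup_tail_cvg0 :
  sup_pos (fun i => \int[lebesgue_measure]_(u in `[t, +oo[)
    (1 - P i [set x | (X i x <= u)%R])) @[t --> +oo%R] --> 0 <->
  sup_pos (fun i => stop_loss (P i) (X i) t) @[t --> +oo%R] --> 0.
Proof.
split; apply: (@sup_pos_cvg0_le _ _ _ _ id 1) => //;
  near=> t => i; rewrite mul1e stop_loss_tail//.
Unshelve. all: by end_near. Qed.

Lemma sup_uniform_integral_cvg0 :
  sup_pos (fun i => \int[P i]_(x in [set x | (t < X i x)%R]) (X i x)%:E)
    @[t --> +oo%R] --> 0 <->
  sup_pos (fun i => stop_loss (P i) (X i) t) @[t --> +oo%R] --> 0.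
Proof.
split.
  apply: (@sup_pos_cvg0_le _ _ _ _ id 1) => //.
  by near=> t => i; rewrite mul1e stop_loss_le.
(* The integral over [X > t] is bounded by twice the transform at [t / 2]. *)
apply: (@sup_pos_cvg0_le _ _ _ _ (fun t => 2^-1 * t)%R 2) => //.
  by apply: gt0_cvgMry => //; rewrite invr_gt0.
near=> t => i.
have -> : t = (2 * (2^-1 * t))%R by rewrite mulrA divff// mul1r.
rewrite [in leRHS]mulrA mulVf// mul1r.
by apply: le_stop_loss => //; rewrite mulr_ge0// invr_ge0.
Unshelve. all: by end_near. Qed.

Lemma incr_convex_excess (t : R) : (0 <= t)%R -> incr_convex_pos (excess t).
Proof.
move=> t0; split; [|split].
- by move=> x _; exact: excess_ge0.
- by move=> x y _ xy; rewrite /excess ge_max !le_max lexx lerB// orbT.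
- move=> x y s _ _ s0 s1; rewrite {1}/excess ge_max.
  rewrite addr_ge0 ?mulr_ge0 ?excess_ge0 ?subr_ge0// andbT.
  have hx : (x - t <= excess t x)%R by rewrite le_max lexx.
  have hy : (y - t <= excess t y)%R by rewrite le_max lexx.
  have s1' : (0 <= 1 - s)%R by rewrite subr_ge0.
  have := ler_wpM2l s0 hx; have := ler_wpM2l s1' hy; nra.
Qed.

Lemma stop_loss_cvg0 {dY : measure_display} {TY : measurableType dY}
  (PY : probability TY R) (Y : TY -> R) : pos_rv Y ->
  PY.-integrable setT (EFin \o Y) -> stop_loss PY Y t @[t --> +oo%R] --> 0.
Proof.
move=> hY iY; apply/cvge_pinftyP => u uy.
(* The bound [(Y - t)_+ <= Y] needs [t >= 0]; [u], which is eventually nonnegative, is replaced by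
   its absolute value so that [Y] dominates every term of the sequence. *)
have uy0 : `|u n|%R @[n --> \oo] --> +oo%R.
  by apply/cvgryPge => A; near=> n; rewrite (le_trans _ (ler_norm _))//; near: n; exact: cvgry_ge.
have -> : 0 = \int[PY]_(x in setT) cst 0 x by rewrite integral0.
apply: (@cvg_trans _ (stop_loss PY Y `|u n|%R @[n --> \oo])).
  apply: near_eq_cvg; near=> n; rewrite ger0_norm//; near: n; exact: cvgry_ge.
apply: (@dominated_cvg _ _ _ PY _ measurableT _ _ (EFin \o Y)) => //.
- by move=> n; exact: measurable_excess.
- move=> x _; apply: cvg_near_cst; near=> n.
  congr EFin; apply/max_idPr; rewrite subr_le0; near: n; exact: cvgry_ge.
- move=> n x _ /=; rewrite ger0_norm ?excess_ge0// lee_fin ge_max.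
  by case: hY => _ Y0; rewrite Y0 lerBlDr lerDl normr_ge0.
Unshelve. all: by end_near. Qed.

Lemma icx_le_sup_cvg0 {dY : measure_display} {TY : measurableType dY}
  (PY : probability TY R) (Y : TY -> R) : pos_rv Y ->
  PY.-integrable setT (EFin \o Y) -> (forall i, icx_le (P i) (X i) PY Y) ->
  sup_pos (fun i => stop_loss (P i) (X i) t) @[t --> +oo%R] --> 0.
Proof.
move=> hY iY XY; apply: (@squeeze_cvge _ _ _ _ (cst 0) _ (stop_loss PY Y)).
- near=> t; rewrite sup_pos_ge0/=; apply: sup_pos_le; first exact: stop_loss_ge0.
  by move=> i; apply: XY; apply: incr_convex_excess.
- exact: cvg_cst.
- exact: stop_loss_cvg0.
Unshelve. all: by end_near. Qed.

End Equivalences.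

(** * Distributions on the natural numbers with prescribed tails *)

Section NatDistribution.
Context {R : realType}.

Lemma nneseries_telescope (f : nat -> R) (l : R) :
  {homo f : m n / (m <= n)%N >-> m <= n} -> f n @[n --> \oo] --> l ->
  (\sum_(k <oo) (f k.+1 - f k)%:E = (l - f 0%N)%:E)%E.
Proof.
move=> ndf fl.
have El : limn (EFin \o f) = l%:E.
  by apply/cvg_lim => //; apply: cvg_EFin => //; near=> n.
under eq_eseriesr do rewrite EFinB.
by rewrite nondecreasing_telescope_sumey// El.
Unshelve. all: by end_near. Qed.

(* The atom at k is Q k - Q k.+1; the series has mass 1, and mnormalize only serves
   to package it as a probability. *)
Lemma nat_probability_of_survival (Q : nat -> R) :
  Q 0%N = 1 -> {homo Q : m n / (m <= n)%N >-> n <= m} ->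
  Q n @[n --> \oo] --> 0 ->
  exists P : probability nat R, forall m, P [set k | (m <= k)%N] = (Q m)%:E.
Proof.
move=> Q0 Qd Ql.
have p0 k : 0 <= Q k - Q k.+1 by rewrite subr_ge0 Qd.
pose mu : {measure set nat -> \bar R} :=
  mseries (fun k => mscale (NngNum (p0 k)) (dirac k : {measure set nat -> \bar R})) 0.
have muE m : mu [set k | (m <= k)%N] = (Q m)%:E.
  (* Freezing the index at [m] makes the increments vanish for [k < m], as does the mass that atoms
     below [m] give to the set; the sign turns the nonincreasing [Q] into a nondecreasing
     sequence. *)
  have := @nneseries_telescope (fun k => - Q (maxn m k)) 0.
  rewrite maxn0 opprK add0r => <-.
  - apply: eq_eseriesr => k _; transitivity ((Q k - Q k.+1) * (k \in [set k | (m <= k)%N])%:R)%:E.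
      by rewrite EFinM -diracE.
    congr EFin.
    have [mk|km] := leqP m k.
      by rewrite mem_set//= mulr1 (maxn_idPr _) 1?leqW// opprK addrC.
    rewrite memNset/=; last by apply/negP; rewrite -ltnNge.
    by rewrite mulr0 (maxn_idPl _)// opprK addNr.
  - by move=> k n kn; rewrite lerN2 Qd// geq_max leq_maxl/= leq_max kn orbT.
  - rewrite -[X in _ --> X]oppr0; apply: cvgN.
    apply: cvg_trans Ql; apply: near_eq_cvg; near=> n.
    by rewrite (maxn_idPr _)//; near: n; exact: nbhs_infty_ge.
have mu1 : mu setT = 1%E.
  by rewrite -[RHS]/(1%:E) -Q0 -muE; congr (mu _); apply/seteqP; split.
exists (mnormalize mu (dirac 0%N)) => m.
by rewrite /= /mnormalize mu1 onee_eq0/= invr1 mule1 muE.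
Unshelve. all: by end_near. Qed.

(** Layer-cake formula: [(k - n)_+] counts the integers [j] with [n <= j < k], so its expectation is
    the sum over [j >= n] of [P (k > j) = h j - h j.+1], which telescopes to [h n]. *)
Lemma stop_loss_nat (P : probability nat R) (h : nat -> R) :
  {homo h : m n / (m <= n)%N >-> n <= m} -> h n @[n --> \oo] --> 0 ->
  (forall m, P [set k | (m < k)%N] = (h m - h m.+1)%:E) ->
  forall n, stop_loss P (fun k => k%:R) n%:R = (h n)%:E.
Proof.
move=> hd hl Ph n.
transitivity (\int[P]_k (\sum_(m <oo) (\1_[set k | (m + n < k)%N] k)%:E))%E.
  apply: eq_integral => k _.
  (* This sequence grows by 1 exactly while [m + n < k], from [minn n k] up to [k]. *)
  have := @nneseries_telescope (fun m => (minn (m + n) k)%:R) k%:R.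
  rewrite add0n => H; rewrite (_ : excess _ _ = k%:R - (minn n k)%:R); last first.
    rewrite /excess; have [nk|kn] := leqP n k.
      by apply/max_idPl; rewrite subr_ge0 ler_nat.
    by rewrite subrr; apply/max_idPr; rewrite subr_le0 ler_nat ltnW.
  rewrite -H.
  - apply: eq_eseriesr => m _; congr EFin; rewrite indicE addSn.
    have [mk|km] := ltnP (m + n) k.
      by rewrite mem_set//= (minn_idPl _)// -natrB// subSnn.
    rewrite memNset/=; last by apply/negP; rewrite -leqNgt.
    by rewrite (minn_idPr _) 1?leqW// subrr.
  - move=> a b ab; rewrite ler_nat leq_min geq_minr andbT.
    by rewrite geq_min leq_add2r ab.
  - apply: cvg_near_cst; near=> m; rewrite (minn_idPr _)//.
    by apply: leq_trans (leq_addr _ _); near: m; exact: nbhs_infty_ge.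
rewrite integral_nneseries//.
have := @nneseries_telescope (fun m => - h (m + n)%N) 0.
rewrite add0n opprK add0r => <-.
- apply: eq_eseriesr => m _; rewrite integral_indic// setIT [LHS](Ph (m + n)%N).
  by rewrite addSn opprK addrC.
- by move=> a b ab; rewrite lerN2 hd// leq_add2r.
- rewrite -[X in _ --> X]oppr0; apply: cvgN.
  by rewrite (cvg_shiftn n h).
Unshelve. all: by end_near. Qed.

End NatDistribution.

(** * Chord interpolation at the integers and reduction to integer thresholds *)

Section NatDominates.
Context {R : realType}.
Variable phi : R -> R.
Hypothesis hphi : incr_convex_pos phi.

(** The jump of slope at [k] of the piecewise linear interpolation of [phi], which is continued by a
    constant to the left of 0; hence the separate value at [k = 0]. *)
Definition second_difference (k : nat) : R :=
  if k is k'.+1 then phi k'.+2%:R - 2 * phi k'.+1%:R + phi k'%:R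
  else phi 1 - phi 0.

(** The values are extended reals so that the series of nonnegative terms can be integrated term by
    term. *)
Definition chord_interpolation (x : R) : \bar R :=
  ((phi 0)%:E + \sum_(k <oo) (second_difference k * excess k%:R x)%:E)%E.

(** Monotonicity settles [k = 0]; otherwise this is convexity at the midpoint of [k - 1] and
    [k + 1]. *)
Lemma second_difference_ge0 k : 0 <= second_difference k.
Proof.
have [_ [phi_nd phi_cvx]] := hphi.
case: k => [|k] /=; first by rewrite subr_ge0 phi_nd.
have := phi_cvx k%:R k.+2%:R 2^-1 (ler0n _ _) (ler0n _ _).
have -> : 2^-1 * k%:R + (1 - 2^-1) * k.+2%:R = k.+1%:R :> R.
  by rewrite -!natr1; field.
by move=> H; have := H ltac:(lra) ltac:(lra); lra.
Qed.

(** The right-hand side is the line through the graph points at [n] and [n.+1]; the next term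
    changes its slope at [n.+1] to that of the following chord. *)
Lemma sum_second_difference (n : nat) (x : R) :
  phi 0 + \sum_(k < n.+1) second_difference k * (x - k%:R) =
  phi n%:R + (x - n%:R) * (phi n.+1%:R - phi n%:R).
Proof.
elim: n => [|n IH]; first by rewrite big_ord_recr big_ord0 /= add0r mulrC.
by rewrite big_ord_recr/= addrA IH -[n.+1%:R]natr1; ring.
Qed.

Let term_ge0 x k : (0 <= (second_difference k * excess k%:R x)%:E)%E.
Proof. by rewrite lee_fin mulr_ge0 ?second_difference_ge0 ?excess_ge0. Qed.

(** To the right of [n] the positive parts of index at most [n] are linear and sum to the chord; the
    later ones stay as a nonnegative remainder. *)
Lemma chord_interpolation_split (n : nat) (x : R) : n%:R <= x ->
  chord_interpolation x =
  ((phi n%:R + (x - n%:R) * (phi n.+1%:R - phi n%:R))%:E +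
   \sum_(n.+1 <= k <oo) (second_difference k * excess k%:R x)%:E)%E.
Proof.
move=> nx; rewrite /chord_interpolation (nneseries_split _ n.+1)//.
rewrite add0n addeA -sum_second_difference EFinD big_mkord sumEFin.
congr (_ + _%:E + _)%E; apply: eq_bigr => k _; congr (_ * _).
apply/max_idPl; rewrite subr_ge0 (le_trans _ nx)// ler_nat -ltnS; exact: ltn_ord.
Qed.

Lemma le_chord_interpolation (x : R) : 0 <= x -> ((phi x)%:E <= chord_interpolation x)%E.
Proof.
move=> x0; have [_ [_ phi_cvx]] := hphi.
have /andP[nx xn] := truncn_itv x0; set n := Num.truncn x in nx xn.
(* The remainder is bounded below by 0, which leaves convexity on the interval from [n] to [n.+1]
   with weight [x - n] at [n.+1]. *)
rewrite (chord_interpolation_split n x nx) -[leLHS]adde0 leeD//; last exact: nneseries_ge0.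
have := phi_cvx n.+1%:R n%:R (x - n%:R) (ler0n _ _) (ler0n _ _).
have s1 : x - n%:R <= 1 by rewrite lerBlDl natr1 ltW.
rewrite subr_ge0 => /(_ nx s1).
rewrite (_ : _ * _ + _ = x); last by rewrite -natr1; ring.
by rewrite lee_fin => /le_trans; apply; rewrite le_eqVlt; apply/orP; left; apply/eqP; ring.
Qed.

Lemma chord_interpolation_nat (n : nat) : chord_interpolation n%:R = (phi n%:R)%:E.
Proof.
rewrite (chord_interpolation_split n n%:R (lexx _)) subrr mul0r addr0 eseries0 ?adde0// => k nk _.
by rewrite (_ : excess _ _ = 0) ?mulr0//; apply/max_idPr; rewrite subr_le0 ler_nat ltnW.
Qed.

Lemma integral_chord_interpolation {d : measure_display} {T : measurableType d}
  (P : probability T R) (X : T -> R) : pos_rv X ->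
  (\int[P]_x chord_interpolation (X x) = (phi 0)%:E +
   \sum_(k <oo) (second_difference k)%:E * stop_loss P X k%:R)%E.
Proof.
move=> hX; have phi0 : 0 <= phi 0 by case: hphi => + _; apply.
have mf k : measurable_fun setT (fun x => (second_difference k * excess k%:R (X x))%:E : \bar R).
  by under eq_fun do rewrite EFinM; apply: measurable_funeM; exact: measurable_excess.
rewrite ge0_integralD//=; last 2 first.
- by move=> x _; exact: nneseries_ge0.
- by apply: ge0_emeasurable_sum => // k x _ _; exact: term_ge0.
congr (_ + _)%E.
  by rewrite integral_cst// -[RHS]mule1 -(probability_setT P).
rewrite integral_nneseries//; apply: eq_eseriesr => k _.
under eq_integral do rewrite EFinM.
rewrite ge0_integralZl_EFin//.
- by move=> x _; rewrite lee_fin excess_ge0.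
- exact: measurable_excess.
- exact: second_difference_ge0.
Qed.

Lemma measurable_chord_interpolation {d : measure_display} {T : measurableType d}
  (X : T -> R) : pos_rv X -> measurable_fun setT (chord_interpolation \o X).
Proof.
move=> hX; apply: emeasurable_funD; first exact: measurable_cst.
apply: ge0_emeasurable_sum => [k x _ _|k _]; first exact: term_ge0.
have : measurable_fun setT (fun x => (second_difference k)%:E * (EFin \o (excess k%:R \o X)) x)%E.
  by apply: measurable_funeM; exact: measurable_excess.
by apply: eq_measurable_fun.
Qed.

Lemma measurable_incr_convex_comp {d : measure_display} {T : measurableType d}
  (X : T -> R) : pos_rv X -> measurable_fun setT (EFin \o (phi \o X)).
Proof.
move=> [mX X0]; apply/measurable_EFinP.
(* [phi] is monotone only on the nonnegative half-line; precomposing with [max x 0] makes it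
   monotone everywhere without changing it on the values of [X]. *)
rewrite (_ : phi \o X = (fun x => phi (Num.max x 0)) \o X); last first.
  by apply/funext => x /=; rewrite (max_idPl _).
apply: measurableT_comp => //; apply: nondecreasing_measurable => // x y xy.
have [_ [phi_nd _]] := hphi.
apply: phi_nd; first by rewrite le_max lexx orbT.
by rewrite ge_max !le_max xy lexx orbT.
Qed.

End NatDominates.

Lemma icx_le_nat {R : realType} {d : measure_display} {T : measurableType d}
  (P : probability T R) (X : T -> R) (hX : pos_rv X)
  {dY : measure_display} {TY : measurableType dY}
  (PY : probability TY R) (N : TY -> nat) (hN : pos_rv (fun y => (N y)%:R : R)) :
  (forall n : nat, stop_loss P X n%:R <= stop_loss PY (fun y => (N y)%:R) n%:R)%E ->
  icx_le P X PY (fun y => (N y)%:R).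
Proof.
move=> XN phi hphi.
apply: (@le_trans _ _ (\int[P]_x chord_interpolation phi (X x))%E).
  apply: ge0_le_integral => //.
  - by move=> x _; rewrite lee_fin; case: hphi => + _; apply; case: hX.
  - exact: measurable_incr_convex_comp.
  - exact: measurable_chord_interpolation.
  - by move=> x _; apply: le_chord_interpolation => //; case: hX.
(* Since [N] is integer-valued, replacing [phi] by its interpolation loses nothing on this side, and
   the two series can be compared term by term. *)
rewrite -[leRHS](_ : \int[PY]_y chord_interpolation phi (N y)%:R = _)%E; last first.
  by apply: eq_integral => y _; exact: chord_interpolation_nat.
rewrite !integral_chord_interpolation//; apply: leeD => //; apply: lee_nneseries => k _.
  by rewrite mule_ge0 ?lee_fin ?second_difference_ge0// stop_loss_ge0.
by rewrite lee_wpmul2l// lee_fin second_difference_ge0.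
Qed.

(** * Monotonicity, slope bound and convexity in the threshold *)

Section StopLossShape.
Context {R : realType} {d : measure_display} {T : measurableType d}.
Variables (P : probability T R) (X : T -> R).
Hypothesis hX : pos_rv X.
Local Open Scope ereal_scope.

Lemma le_stop_loss_subr (s t : R) : (s <= t)%R ->
  stop_loss P X t <= stop_loss P X s.
Proof.
move=> st; apply: ge0_le_integral => //.
- by move=> x _; rewrite lee_fin excess_ge0.
- exact: measurable_excess.
- exact: measurable_excess.
- by move=> x _; rewrite lee_fin ge_max excess_ge0 andbT le_max lerB.
Qed.

(** Slopes are at least -1, because [(x - s)_+ <= (x - t)_+ + (t - s)] pointwise. *)
Lemma stop_loss_le_addr (s t : R) : (s <= t)%R ->
  stop_loss P X s <= stop_loss P X t + (t - s)%:E.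
Proof.
move=> st.
rewrite -[(t - s)%:E]mule1 -(probability_setT P) -integral_cst// -ge0_integralD//; last 3 first.
- by move=> x _; rewrite lee_fin excess_ge0.
- exact: measurable_excess.
- by move=> x _; rewrite lee_fin subr_ge0.
apply: ge0_le_integral => //.
- by move=> x _; rewrite lee_fin excess_ge0.
- exact: measurable_excess.
- by apply: emeasurable_funD => //; exact: measurable_excess.
- move=> x _ /=; rewrite -EFinD lee_fin ge_max addr_ge0 ?excess_ge0 ?subr_ge0// andbT.
  have : (X x - t <= excess t (X x))%R by rewrite le_max lexx.
  lra.
Qed.

(** Integrates the midpoint convexity of the map from [t] to [(x - t)_+]. *)
Lemma stop_loss_midpoint (s t : R) :
  2%:E * stop_loss P X ((s + t) / 2) <= stop_loss P X s + stop_loss P X t.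
Proof.
rewrite -ge0_integralZl_EFin//; last 2 first.
- by move=> x _; rewrite lee_fin excess_ge0.
- exact: measurable_excess.
rewrite -ge0_integralD//; last 4 first.
- by move=> x _; rewrite lee_fin excess_ge0.
- exact: measurable_excess.
- by move=> x _; rewrite lee_fin excess_ge0.
- exact: measurable_excess.
apply: ge0_le_integral => //.
- by move=> x _; rewrite mule_ge0// lee_fin excess_ge0.
- by apply: measurable_funeM; exact: measurable_excess.
- by apply: emeasurable_funD; exact: measurable_excess.
move=> x _; rewrite -EFinM -EFinD lee_fin.
have hs : (X x - s <= excess s (X x))%R by rewrite le_max lexx.
have ht : (X x - t <= excess t (X x))%R by rewrite le_max lexx.
have := excess_ge0 s (X x); have := excess_ge0 t (X x).
rewrite {3}/excess; case: (leP (X x - (s + t) / 2)%R 0%R); lra.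
Qed.

End StopLossShape.

(** * Construction of the dominating integer-valued variable *)

Lemma exists_icx_bound {R : realType} {I : Type} {d : I -> measure_display}
  {T : forall i, measurableType (d i)}
  (P : forall i, probability (T i) R) (X : forall i, T i -> R)
  (hX : forall i, pos_rv (X i)) :
  (sup_pos (fun i => stop_loss (P i) (X i) t) @[t --> +oo%R] --> 0)%E ->
  exists PY : probability nat R,
    [/\ pos_rv (fun k : nat => k%:R : R),
      PY.-integrable setT (EFin \o (fun k : nat => k%:R : R))
    & forall i, icx_le (P i) (X i) PY (fun k : nat => k%:R)].
Proof.
move=> H0.
pose H n := sup_pos (fun i => stop_loss (P i) (X i) n%:R).
have SLH i n : (stop_loss (P i) (X i) n%:R <= H n)%E.
  exact: (sup_pos_ub (fun i => stop_loss (P i) (X i) n%:R)).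
have Hge0 n : (0 <= H n)%E by exact: sup_pos_ge0.
have HN : (H n @[n --> \oo] --> 0)%E by exact: (cvg_comp _ _ (@cvgr_idn R) H0).
have /fine_cvgP [Hfin hl] := HN.
(* Convergence gives finiteness only from some [N] on; monotonicity and the slope bound carry it to
   every [n] through [H n <= H N + N]. *)
have {}Hfin n : H n \is a fin_num.
  have [N _ /(_ N (leqnn N)) /= HNfin] := Hfin.
  rewrite ge0_fin_numE//; apply: (@le_lt_trans _ _ (H N + N%:R%:E)%E).
    apply: sup_pos_le; first by rewrite adde_ge0.
    move=> i; apply: le_trans (le_stop_loss_subr (P i) (X i) (hX i) 0 n%:R (ler0n _ _)) _.
    apply: le_trans (stop_loss_le_addr (P i) (X i) (hX i) 0 N%:R (ler0n _ _)) _.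
    by rewrite subr0 leeD2r.
  by rewrite lte_add_pinfty ?ltry// -ge0_fin_numE.
pose h n := fine (H n).
have hE n : H n = (h n)%:E by rewrite /h fineK.
have hd : {homo h : m n / (m <= n)%N >-> n <= m}.
  move=> m n mn; rewrite -lee_fin -!hE; apply: sup_pos_le => // i.
  by apply: le_trans (SLH i m); apply: le_stop_loss_subr => //; rewrite ler_nat.
have h1 : h 0%N <= h 1%N + 1.
  rewrite -lee_fin EFinD -!hE; apply: sup_pos_le => [|i]; first by rewrite adde_ge0.
  apply: le_trans (stop_loss_le_addr (P i) (X i) (hX i) 0 1 ler01) _.
  by rewrite subr0 leeD2r//; exact: (SLH i 1%N).
have h2 n : 2 * h n.+1 <= h n + h n.+2.
  (* The factor 2 is moved to the right so that the left side is a bare supremum, to be bounded for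
     each [i]. *)
  rewrite -lee_fin EFinM (EFinD (h n)) -!hE -lee_pdivlMl//; apply: sup_pos_le => [|i].
    by rewrite mule_ge0 ?adde_ge0// lee_fin invr_ge0.
  rewrite lee_pdivlMl//; apply: le_trans (leeD (SLH i n) (SLH i n.+2)).
  have -> : n.+1%:R = (n%:R + n.+2%:R) / 2 :> R by rewrite -!natr1; field.
  exact: stop_loss_midpoint.
(* [Q n] is to be [P (Y >= n)], so the prescribed [P (Y > m)] sits at index [m.+1]. Then [h1] gives
   [Q 1 <= Q 0] and [h2] the later inequalities. *)
pose Q n := if n is m.+1 then h m - h m.+1 else 1.
have Qd : {homo Q : m n / (m <= n)%N >-> n <= m}.
  apply/nonincreasing_seqP => -[|n] /=; first by have := h1; lra.
  by have := h2 n; lra.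
have Ql : Q n @[n --> \oo] --> 0.
  rewrite -cvg_shiftS.
  have : h n - h n.+1 @[n --> \oo] --> 0 - 0.
    by apply: cvgB; rewrite ?(cvg_shiftS h).
  by rewrite subrr.
have [PY PYE] := nat_probability_of_survival Q erefl Qd Ql.
have SLY n : stop_loss PY (fun k => k%:R) n%:R = (h n)%:E.
  by apply: stop_loss_nat => // m; rewrite (PYE m.+1).
have hY : pos_rv (fun k : nat => k%:R : R) by split.
exists PY; split => //.
- apply/integrableP; split; first exact/measurable_EFinP.
  (* The expectation of [Y] is its stop-loss transform at 0, namely [h 0]. *)
  rewrite [ltLHS](_ : _ = stop_loss PY (fun k => k%:R) 0%:R); first by rewrite SLY ltry.
  apply: eq_integral => k _ /=; congr EFin.
  by rewrite ger0_norm// /excess subr0; apply/esym/max_idPl.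
- by move=> i; apply: icx_le_nat => // n; rewrite SLY -hE.
Qed.

Theorem mainTheorem1 (R : realType) (I : Type)
  (d : I -> measure_display) (T : forall i, measurableType (d i))
  (P : forall i, probability (T i) R) (X : forall i, T i -> R)
  (hX : forall i, pos_rv (X i)) :
  let F := fun i (t : R) => P i [set x | X i x <= t] in
  let cond_i := exists (dY : measure_display) (TY : measurableType dY)
          (PY : probability TY R) (Y : TY -> R),
          [/\ pos_rv Y, PY.-integrable setT (EFin \o Y)
            & forall i, icx_le (P i) (X i) PY Y] in
  let cond_ii := sup_pos (fun i => (\int[P i]_(x in [set x | ((t:R) < X i x)%R]) (X i x)%:E)%E)
              @[t --> +oo] --> 0%E in
  let cond_iii := sup_pos (fun i =>
                    (\int[lebesgue_measure]_(u in `[(t:R), +oo[) (1%:E - F i u))%E)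
              @[t --> +oo] --> 0%E in
  (cond_i <-> cond_ii) /\ (cond_ii <-> cond_iii).
Proof.
move=> F cond_i cond_ii cond_iii.
have ii_sl := sup_uniform_integral_cvg0 P X hX.
have iii_sl := sup_tail_cvg0 P X hX.
split; last by rewrite /cond_ii ii_sl -iii_sl.
rewrite /cond_ii ii_sl; split.
  move=> [dY [TY [PY [Y [hY iY XY]]]]].
  exact: icx_le_sup_cvg0 XY.
move=> /(exists_icx_bound P X hX)[PY [hY iY XY]].
by do 2 eexists; exists PY, (fun k => k%:R); split.
Qed.
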